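(* Let $(P,\le)$ be a finite partially ordered set and let $I$ be an irreducible upper set of $P$. Then $\chi_I$ is a prime element of $\mathrm{M}(P)$ if and only if: 1. there is $v\in P$ such that $I=\uparrow\{v\}$; 2. if $x\in P\setminus I$ satisfies $\uparrow\{x\}\cap I\ne\emptyset$, then $x\le v$; 3. the set $\{x\in P\setminus I\mid \uparrow\{x\}\cap I\ne\emptyset\}$ is either empty or has a maximum.
   Context: $\uparrow X=\{y\in P\mid x\le y\text{ for some }x\in X\}$; an upper set is $U$ with $\uparrow U=U$; an irreducible upper set is a nonempty upper set that is not the union of two disjoint nonempty upper sets; $\chi_I$ is the indicator function of $I$. $\mathrm{M}(P)$ is the monoid under pointwise addition of monotone functions $P\to\mathbb{N}$; $f\le_{\mathrm{M}(P)}g$ means $g-f\in\mathrm{M}(P)$; $a$ is prime if $a\le_{\mathrm{M}(P)}b+c$ implies $a\le_{\mathrm{M}(P)}b$ or $a\le_{\mathrm{M}(P)}c$. *)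

(* Defs.v *)
From HB Require Import structures.
From mathcomp Require Import all_boot all_order all_algebra.
Set Implicit Arguments.
Unset Strict Implicit.
Unset Printing Implicit Defensive.
Import Order.TTheory GRing.Theory.
Local Open Scope order_scope.

Section UpperSets.
Context {d : Order.disp_t} {P : finPOrderType d}.
Implicit Types X U I : {set P}.

Definition upset X : {set P} := [set y | [exists x in X, x <= y]].

Definition upper_set U : Prop := upset U = U.

Definition irreducible_upper_set I : Prop :=
  [/\ upper_set I, I != set0 &
      ~ exists A B : {set P},
          [/\ upper_set A, upper_set B, A != set0, B != set0 &
              [disjoint A & B] /\ I = A :|: B]].

Lemma irreducible_upper I : irreducible_upper_set I -> upper_set I.
Proof. by case. Qed.

Definition monotone_ffun : {pred {ffun P -> nat}} :=
  fun f => [forall x, forall y, (x <= y) ==> (f x <= f y)%N].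

Lemma monotone_ffunP (f : {ffun P -> nat}) :
  reflect (forall x y, x <= y -> (f x <= f y)%N) (f \in monotone_ffun).
Proof.
apply: (iffP forallP) => [mf x y lexy|mf x].
  by move/forallP/(_ y)/implyP: (mf x); apply.
by apply/forallP => y; apply/implyP; exact: mf.
Qed.

Fact monotone_ffun_nmod_closed : Algebra.nmod_closed monotone_ffun.
Proof.
split=> [|f g /monotone_ffunP mf /monotone_ffunP mg].
  by apply/monotone_ffunP => x y _; rewrite !ffunE.
apply/monotone_ffunP => x y lexy; rewrite !ffunE.
by apply: leq_add; [exact: mf | exact: mg].
Qed.

Definition indicator X : {ffun P -> nat} := [ffun x => (x \in X) : nat].

Lemma indicator_monotone U : upper_set U -> indicator U \in monotone_ffun.
Proof.
move=> upU; apply/monotone_ffunP => x y lexy; rewrite !ffunE.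
case: (boolP (x \in U)) => // xU; suff -> : y \in U by [].
by rewrite -upU inE; apply/existsP; exists x; rewrite xU.
Qed.

End UpperSets.

Record monotone_monoid (d : Order.disp_t) (P : finPOrderType d) :=
  MonotoneMonoid {
    monotone_val :> {ffun P -> nat};
    _ : monotone_ffun monotone_val }.

Section MonotoneMonoid.
Context (d : Order.disp_t) (P : finPOrderType d).

HB.instance Definition _ := [isSub for @monotone_val d P].
HB.instance Definition _ := [Choice of monotone_monoid P by <:].
HB.instance Definition _ :=
  GRing.SubChoice_isSubNmodule.Build {ffun P -> nat} monotone_ffun
    (monotone_monoid P) monotone_ffun_nmod_closed.

End MonotoneMonoid.

Definition chi (d : Order.disp_t) (P : finPOrderType d) (U : {set P})
    (upU : upper_set U) : monotone_monoid P :=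
  MonotoneMonoid (indicator_monotone upU).

(* Since [nat] is cancellative, [g - f] lies in the monoid exactly when
   [g = f + h] for some [h] in it. *)
Definition monoid_le (M : nmodType) (f g : M) : Prop :=
  exists h : M, g = (f + h)%R.

(* Only the divisibility condition: no non-invertibility clause. *)
Definition monoid_prime (M : nmodType) (a : M) : Prop :=
  forall b c : M,
    monoid_le a (b + c)%R -> monoid_le a b \/ monoid_le a c.

(* Main.v *)
(* [chi_I] divides [f] exactly when [f] is positive on [I] and strictly
   increases along every comparable pair entering [I].  If the elements below
   [I] but outside it have a maximum [m <= v], where [v] is the minimum of [I],
   this reduces to the single inequality [f m < f v] (or [0 < f v] if there are
   no such elements), which is inherited by a summand of [b + c].  Conversely,
   each condition that fails yields upper sets [A] and [B] such that [chi_I]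
   divides [chi_A + chi_B] but neither summand:
   - two minimal elements [v], [w] of [I]: remove one of them from [I];
   - [x] not below [v]: take [I] minus [v] and the union of [I] and [upset x];
   - two maximal elements [m], [n] outside [I]: take the unions of [I] with
     [upset m] and with [upset n]. *)
Require Import Defs.
From mathcomp Require Import all_boot all_order all_algebra.

Set Implicit Arguments.
Unset Strict Implicit.
Unset Printing Implicit Defensive.
Import Order.TTheory.

(** * Closure properties of upper sets *)

Section UpperSetTheory.
Context (d : Order.disp_t) (P : finPOrderType d).
Implicit Types (x y : P) (X A B I : {set P}).
Local Open Scope order_scope.

Lemma in_upset1 x y : (y \in upset [set x]) = (x <= y).
Proof.
rewrite inE; apply/existsP/idP => [[z /andP[]]|lexy].
  by rewrite inE => /eqP->.
by exists x; rewrite inE eqxx.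
Qed.

Lemma upper_setP X :
  upper_set X <-> (forall x y, x \in X -> x <= y -> y \in X).
Proof.
split=> [upX x y xX lexy|closedX].
  by rewrite -upX inE; apply/existsP; exists x; rewrite xX.
apply/setP=> y; rewrite inE; apply/existsP/idP => [[x /andP[xX]]|yX].
  exact: closedX.
by exists y; rewrite yX lexx.
Qed.

Lemma upper_setU A B : upper_set A -> upper_set B -> upper_set (A :|: B).
Proof.
move=> /upper_setP upA /upper_setP upB; apply/upper_setP=> x y.
rewrite !inE => /orP[xA|xB] lexy; first by rewrite (upA x).
by rewrite (upB x) ?orbT.
Qed.

Lemma upper_upset1 x : upper_set (upset [set x]).
Proof. by apply/upper_setP=> y z; rewrite !in_upset1; exact: le_trans. Qed.

Lemma upper_setD1 I v :
    upper_set I -> (forall x, x \in I -> x <= v -> x = v) ->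
  upper_set (I :\ v).
Proof.
move=> /upper_setP upI minv; apply/upper_setP=> x y.
rewrite !inE => /andP[xNv xI] lexy; rewrite (upI x) // andbT.
by apply: contraNneq xNv => yv; rewrite (minv x) // -yv.
Qed.

Lemma meets_upset1P I x :
  reflect (exists2 y, y \in I & x <= y) (upset [set x] :&: I != set0).
Proof.
apply: (iffP (set0Pn _)) => -[y].
  by rewrite inE in_upset1 => /andP[]; exists y.
by move=> yI lexy; exists y; rewrite inE in_upset1 lexy.
Qed.

End UpperSetTheory.

(** Take [m] in [A] below [x] with the fewest elements of [P] below it: a strictly smaller element
    would have a strictly smaller down-set. *)
Lemma ex_minimal (d : Order.disp_t) (P : finPOrderType d) (A : {set P})
    (x : P) : x \in A ->
  exists m, [/\ m \in A, (m <= x)%O &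
    forall y, y \in A -> (y <= m)%O -> y = m].
Proof.
move=> xA; pose below i := [set z : P | (z <= i)%O].
pose Ax i := (i \in A) && (i <= x)%O.
have Axx : Ax x by rewrite /Ax xA lexx.
case: (arg_minnP (fun i => #|below i|) Axx) => m /andP[mA lemx] minm.
exists m; split=> // y yA leym; apply/eqP; rewrite eq_le leym /=.
have sub_ym : below y \subset below m.
  by apply/subsetP=> z; rewrite !inE => /le_trans; exact.
have card_my : #|below m| <= #|below y|.
  by apply: minm; rewrite /Ax yA (le_trans leym).
have /eqP/setP/(_ m) : below y == below m by rewrite eqEcard sub_ym.
by rewrite !inE lexx.
Qed.

Lemma ex_maximal (d : Order.disp_t) (P : finPOrderType d) (A : {set P})
    (x : P) : x \in A ->
  exists m, [/\ m \in A, (x <= m)%O &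
    forall y, y \in A -> (m <= y)%O -> y = m].
Proof. exact: (@ex_minimal _ P^d A x). Qed.

(** * Divisibility by an indicator function *)

Section Divisibility.
Context (d : Order.disp_t) (P : finPOrderType d).
Implicit Types (x y : P) (A B I : {set P}) (f g : monotone_monoid P).
Local Open Scope order_scope.

Lemma monotone_valD f g x : (f + g)%R x = (f x + g x)%N.
Proof. by rewrite [monotone_val _]/= ffunE. Qed.

Lemma chiE I (upI : upper_set I) x : chi upI x = (x \in I).
Proof. by rewrite ffunE. Qed.

Lemma monotone_monoidP f x y : x <= y -> (f x <= f y)%N.
Proof. exact: (monotone_ffunP _ (valP f)). Qed.

Lemma chi_leP I (upI : upper_set I) f :
  monoid_le (chi upI) f <->
  (forall x, x \in I -> 0 < f x)%N /\
  (forall x y, x \notin I -> y \in I -> x <= y -> (f x < f y)%N).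
Proof.
split=> [[h ->]|[pos incr]].
  split=> [x xI|x y xI yI lexy]; rewrite !monotone_valD !chiE.
    by rewrite xI.
  by rewrite (negPf xI) yI add0n add1n ltnS monotone_monoidP.
have leI x : ((x \in I) <= f x)%N by case: (boolP (x \in I)) => // /pos.
(* The quotient can only be [f - chi I], and [leI] makes the truncated subtraction exact.
   Monotonicity is at risk only on pairs entering [I], where strict increase absorbs the 1
   subtracted. *)
have mh : [ffun x => f x - (x \in I)]%N \in @monotone_ffun d P.
  apply/monotone_ffunP=> x y lexy; rewrite !ffunE.
  have [xI|xI] := boolP (x \in I).
    by rewrite ((upper_setP I).1 upI x y xI lexy) leq_sub2r ?monotone_monoidP.
  have [yI|yI] := boolP (y \in I); last by rewrite !subn0 monotone_monoidP.
  by rewrite subn0 subn1 -ltnS prednK ?incr // pos.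
exists (MonotoneMonoid mh); apply/val_inj/ffunP=> x.
by rewrite [RHS]monotone_valD chiE ffunE subnKC.
Qed.

(** Common frame of the three counterexamples: for 0/1-valued functions, a strict increase means
    going from 0 to 1, so divisibility becomes a condition on sets. *)
Lemma chi_prime_chiD I (upI : upper_set I) A B :
    monoid_prime (chi upI) -> upper_set A -> upper_set B ->
    (forall x, x \in I -> (x \in A) || (x \in B)) ->
    (forall x y, x \notin I -> y \in I -> x <= y ->
      ((x \in A) + (x \in B) < (y \in A) + (y \in B))%N) ->
  let chi_divides X := I \subset X /\
    (forall x y, x \notin I -> y \in I -> x <= y -> x \notin X) in
  chi_divides A \/ chi_divides B.
Proof.
move=> primeI upA upB pos incr; have divides X (upX : upper_set X) :
    monoid_le (chi upI) (chi upX) ->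
    I \subset X /\
    (forall x y, x \notin I -> y \in I -> x <= y -> x \notin X).
  case/chi_leP=> posX incrX; split=> [|x y xI yI lexy].
    by apply/subsetP=> x /posX; rewrite chiE lt0b.
  by have := incrX x y xI yI lexy; rewrite !chiE; do 2 case: (_ \in X).
have /primeI[] : monoid_le (chi upI) (chi upA + chi upB)%R.
- apply/chi_leP; split=> [x /pos|x y xI yI lexy].
    by rewrite monotone_valD !chiE addn_gt0 !lt0b.
  by rewrite !monotone_valD !chiE incr.
- by move/divides; left.
- by move/divides; right.
Qed.

Lemma chi_prime_principal I (upI : upper_set I) :
  I != set0 -> monoid_prime (chi upI) -> exists v, I = upset [set v].
Proof.
move=> /set0Pn[x0 x0I] primeI; have [v [vI _ minv]] := ex_minimal x0I.
exists v; apply/setP=> x; rewrite in_upset1; apply/idP/idP; last first.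
  exact: ((upper_setP I).1 upI).
move=> xI; have [w [wI lewx minw]] := ex_minimal xI.
have [<-//|wNv] := eqVneq w v.
(* Since [w != v], each element of [I] survives in one of the two sets, and elements outside [I] lie
   in neither; yet each set misses a point of [I]. *)
have [x' x'I|x' y x'I yI _|[/subsetP/(_ v vI)]|[/subsetP/(_ w wI)]] :=
  chi_prime_chiD primeI (upper_setD1 upI minv) (upper_setD1 upI minw).
- rewrite !inE x'I !andbT -negb_and.
  by apply/negP=> /andP[/eqP-> /eqP vw]; rewrite vw eqxx in wNv.
- rewrite !inE (negPf x'I) yI !andbF !andbT addn_gt0 !lt0b -negb_and.
  by apply/negP=> /andP[/eqP-> /eqP vw]; rewrite vw eqxx in wNv.
- by rewrite !inE eqxx.
- by rewrite !inE eqxx.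
Qed.

Lemma chi_prime_le_min v (upI : upper_set (upset [set v])) x y :
    monoid_prime (chi upI) ->
    x \notin upset [set v] -> v <= y -> x <= y ->
  x <= v.
Proof.
move=> primeI xI levy lexy; apply/contraT => xNv.
have minv z : z \in upset [set v] -> z <= v -> z = v.
  by rewrite in_upset1 => levz lezv; apply/le_anti; rewrite lezv.
have [z zI|z w zI wI lezw|[/subsetP/(_ v)]|[_ /(_ x y xI)]] :=
  chi_prime_chiD primeI (upper_setD1 upI minv)
                 (upper_setU upI (upper_upset1 x)).
- by rewrite in_setU zI orbT.
(* The sum is at most 1 at [z]. It is 2 at [w] unless [w = v], where it is 1; then it must vanish at
   [z], and it does, since [x <= z <= v] is excluded. *)
- rewrite !in_setU !in_setD1 wI (negPf zI) andbF andbT in_upset1 /= add0n.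
  have [wv|] := eqVneq w v; last by rewrite addn1 ltnS leq_b1.
  rewrite add0n ltnS leqn0 eqb0; apply: contraNN xNv => lexz.
  by rewrite -wv (le_trans lexz).
- by rewrite in_setD1 eqxx in_upset1 lexx => /(_ isT).
- by rewrite in_setU !in_upset1 lexx orbT => /(_ levy lexy).
Qed.

Lemma chi_prime_unique_maximal v (upI : upper_set (upset [set v])) m n :
    let D := [set x | x < v] in
    monoid_prime (chi upI) ->
    (forall x y, x \notin upset [set v] -> v <= y -> x <= y -> x <= v) ->
    m \in D -> (forall x, x \in D -> m <= x -> x = m) ->
    n \in D -> (forall x, x \in D -> n <= x -> x = n) ->
  m = n.
Proof.
move=> D primeI le_v mD maxm nD maxn; apply/eqP/contraT => mNn.
have vI : v \in upset [set v] by rewrite in_upset1.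
have notI x : x \in D -> x \notin upset [set v].
  by rewrite inE in_upset1 => ltxv; rewrite lt_geF.
have leD x : x \in D -> x <= v by rewrite inE => /ltW.
have [x xI|x y xI yI lexy|[_ /(_ m v)]|[_ /(_ n v)]] :=
  chi_prime_chiD primeI (upper_setU upI (upper_upset1 m))
                 (upper_setU upI (upper_upset1 n)).
- by rewrite in_setU xI.
(* The sum is 2 at [y]; it could be 2 at [x] only if [x] were above both [m] and [n], and maximality
   would then give [m = x = n]. *)
- rewrite !in_setU yI (negPf xI) !in_upset1 /=.
  have xD : x \in D.
    rewrite in_upset1 in yI; rewrite inE lt_neqAle (le_v x y) // andbT.
    by apply: contraNneq xI => ->.
  have : ~~ ((m <= x) && (n <= x)).
    apply: contraNN mNn => /andP[/(maxm x xD) <- /(maxn x xD) ->]; exact: eqxx.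
  by case: (m <= x); case: (n <= x).
- move=> /(_ (notI _ mD) vI (leD _ mD)).
  by rewrite in_setU !in_upset1 lexx orbT.
- move=> /(_ (notI _ nD) vI (leD _ nD)).
  by rewrite in_setU !in_upset1 lexx orbT.
Qed.

End Divisibility.

Theorem theorem17 (d : Order.disp_t) (P : finPOrderType d) (I : {set P})
    (irrI : irreducible_upper_set I) :
  monoid_prime (chi (irreducible_upper irrI)) <->
  exists v : P,
    [/\ I = upset [set v],
        forall x : P, x \notin I -> upset [set x] :&: I != set0 ->
          (x <= v)%O &
        let D := [set x | (x \notin I) && (upset [set x] :&: I != set0)] in
        D = set0 \/
        exists m : P, m \in D /\ forall x : P, x \in D -> (x <= m)%O].
Proof.
have [_ I0 _] := irrI; move: (irreducible_upper irrI) => upI.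
split=> [primeI|[v [defI le_v]]] /=.
  have [v defI] := chi_prime_principal I0 primeI.
  subst I; exists v.
  have le_v x y : x \notin upset [set v] -> (v <= y)%O -> (x <= y)%O ->
      (x <= v)%O by exact: chi_prime_le_min primeI.
  split=> // [x xI /meets_upset1P[y]|].
    by rewrite in_upset1; exact: le_v.
  have -> : [set x | (x \notin upset [set v]) &&
      (upset [set x] :&: upset [set v] != set0)] = [set x | (x < v)%O].
    apply/setP=> x; rewrite [LHS]in_set [RHS]in_set; apply/andP/idP.
      case=> xI /meets_upset1P[y]; rewrite in_upset1 => levy lexy.
      rewrite lt_neqAle (le_v x y) // andbT; apply: contraNneq xI => ->.
      by rewrite in_upset1.
    move=> ltxv; split; first by rewrite in_upset1 lt_geF.
    by apply/meets_upset1P; exists v; rewrite ?in_upset1 // ltW.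
  have [->|/set0Pn[x0 x0D]] := eqVneq [set x | (x < v)%O] set0; first by left.
  (* In a finite poset a unique maximal element is a maximum: each [x] lies below some maximal [n],
     and [n = m]. *)
  have [m [mD _ maxm]] := ex_maximal x0D; right; exists m; split=> // x xD.
  have [n [nD lexn maxn]] := ex_maximal xD.
  by rewrite (chi_prime_unique_maximal primeI le_v mD maxm nD maxn).
have vI : v \in I by rewrite defI in_upset1.
have lev y : y \in I -> (v <= y)%O by rewrite defI in_upset1.
have posI (f : monotone_monoid P) y : y \in I -> 0 < f v -> 0 < f y.
  by move=> /lev levy fv; apply: leq_trans fv _; exact: monotone_monoidP.
case=> [D0|[m []]].
  move=> b c /chi_leP[/(_ v vI)]; rewrite monotone_valD addn_gt0 => bcv _.
  have dvd (f : monotone_monoid P) : (0 < f v)%N -> monoid_le (chi upI) f.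
    move=> fv; apply/chi_leP; split=> [x xI|x y xI yI lexy]; first exact: posI.
    move/setP/(_ x): D0; rewrite !inE xI /= => /meets_upset1P[].
    by exists y.
  by case/orP: bcv => /dvd; [left|right].
rewrite inE => /andP[mI mD] maxm b c /chi_leP[_ /(_ m v mI vI (le_v m mI mD))].
rewrite !monotone_valD => ltbc.
(* For [x] outside [I] and below [y] in [I], the chain is [f x <= f m < f v <= f y]. *)
have dvd (f : monotone_monoid P) : (f m < f v)%N -> monoid_le (chi upI) f.
  move=> ltf; apply/chi_leP; split=> [x xI|x y xI yI lexy].
    by apply: posI => //; apply: leq_ltn_trans ltf.
  have lexm : (x <= m)%O.
    by apply: maxm; rewrite inE xI; apply/meets_upset1P; exists y.
  apply: leq_ltn_trans (monotone_monoidP f lexm) _.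
  by apply: leq_trans ltf _; apply: monotone_monoidP; exact: lev.
(* If [b v <= b m], cancelling [b m] in [b m + c m < b v + c v <= b m + c v] leaves [c m < c v]. *)
have [/dvd|lebv] := ltnP (b m) (b v); [by left|right; apply: dvd].
by rewrite -(ltn_add2l (b m)) (leq_trans ltbc) ?leq_add2r.
Qed.
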